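(* Let $K$ be a $2$-bridge knot and let $p/q$ be any fraction corresponding to $K$. Suppose that, starting from some expansion of $p/q$ and repeatedly applying the reductions (1)–(3) described in the context until none can be applied, one obtains an expansion of length $n$. Then $n$ is the minimal length of all expansions of all fractions corresponding to $K$.
   Context: A $2$-bridge knot is written $S(q,p)$ in Schubert's notation, with $p,q$ coprime integers and $q\ge 3$ odd. $S(q,p)$ and $S(q',p')$ are equivalent if and only if $q'=q$ and $p'\equiv p^{\pm1}\pmod q$. The fractions corresponding to $K$ are all $p/q$ with $K=S(q,p)$. For integers $r,b_1,\dots,b_n$ write $$r+[b_1,\dots,b_n]=r+\cfrac{1}{b_1-\cfrac{1}{b_2-\cfrac{1}{\ddots-\cfrac{1}{b_n}}}}$$ (evaluated in $\mathbb{Q}\cup\{\infty\}$ with $1/0=\infty$, $1/\infty=0$). An expansion of $p/q$ is such an expression equal to $p/q$ with $r,b_i\in\mathbb{Z}$, all $b_i\ne0$; its length is $n$. Reductions ($\varepsilon=\pm1$; blocks are of consecutive coefficients; zero coefficients may temporarily appear): (1) Removal of a coefficient $0$: $[\dots,a,0,b,\dots]=[\dots,a+b,\dots]$; $[\dots,a,b,0]=[\dots,a]$; $[0,a,b,\dots]=-a+[b,\dots]$. (2) Removal of a coefficient $\varepsilon$: $[\dots,a,\varepsilon,b,\dots]=[\dots,a-\varepsilon,b-\varepsilon,\dots]$; $[\dots,a,\varepsilon]=[\dots,a-\varepsilon]$; $r+[\varepsilon,a,\dots]=(r+\varepsilon)+[a-\varepsilon,\dots]$. (3) Removal of a block $2\varepsilon,3\varepsilon,\dots,3\varepsilon,2\varepsilon$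 of length $m\ge2$ (the $m-2\geq 0$ inner entries are all $3\varepsilon$): the block is replaced by a block of $m-1$ coefficients all equal to $-3\varepsilon$; the coefficient immediately before the block (if there is one) is decreased by $\varepsilon$, and if the block is at the beginning then instead $r$ is replaced by $r+\varepsilon$; the coefficient immediately after the block (if there is one) is decreased by $\varepsilon$. All these reductions preserve the value and decrease the length. *)

(* Defs.v *)
From mathcomp Require Import all_boot all_order all_algebra.
From Stdlib Require Export Relation_Operators.

Set Implicit Arguments.
Unset Strict Implicit.
Unset Printing Implicit Defensive.

Import Order.TTheory GRing.Theory Num.Theory.
Local Open Scope ring_scope.

(* A 2-bridge knot is given by a Schubert normal form S(q,p); by Schubert's
   classification, equivalence of knots is the relation [schubert_equiv]. *)
Record schubert := Schubert {
  sq : int;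
  sp : int;
  sq_ge3 : 3 <= sq;
  sq_odd : ~~ (2 %| sq)%Z;
  sp_coprime : coprimez sp sq
}.

(* The second disjunct is sp K' = (sp K)^-1 modulo sq K. *)
Definition schubert_equiv (K K' : schubert) : Prop :=
  sq K' = sq K /\
  ((sp K' = sp K %[mod sq K])%Z \/ (sp K' * sp K = 1 %[mod sq K])%Z).

Definition fraction_of (K : schubert) (x : rat) : Prop :=
  exists K' : schubert, schubert_equiv K K' /\ x = (sp K')%:Q / (sq K')%:Q.

(* [option rat] is the set of rationals together with infinity = [None]. *)
Definition pinv (x : option rat) : option rat :=
  match x with
  | None => Some 0
  | Some a => if a == 0 then None else Some a^-1
  end.

Definition paddz (r : int) (x : option rat) : option rat :=
  omap (fun a => r%:Q + a) x.

Definition popp (x : option rat) : option rat := omap -%R x.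

(* [b_1, ..., b_n] = 1 / (b_1 - [b_2, ..., b_n]), the empty bracket being 0. *)
Fixpoint bracket (s : seq int) : option rat :=
  match s with
  | [::] => Some 0
  | b :: s' => pinv (paddz b (popp (bracket s')))
  end.

(* The pair (r, [:: b_1; ...; b_n]) stands for r + [b_1, ..., b_n]. *)
Definition cfexpr := (int * seq int)%type.

Definition cfvalue (e : cfexpr) : option rat := paddz e.1 (bracket e.2).

Definition cflength (e : cfexpr) : nat := size e.2.

Definition is_expansion (x : rat) (e : cfexpr) : Prop :=
  cfvalue e = Some x /\ all (fun b => b != 0) e.2.

Definition is_sign (eps : int) : Prop := eps = 1 \/ eps = -1.

(* 2 eps, 3 eps, ..., 3 eps, 2 eps, of length m when m >= 2. *)
Definition block23 (eps : int) (m : nat) : seq int :=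
  2 * eps :: rcons (nseq (m - 2) (3 * eps)) (2 * eps).

(* All reductions preserve [cfvalue]; s and t may be empty. The cases left out,
   such as r + [a, 0] or r + [eps], have their value in Z or infinite. *)
Inductive reduction : cfexpr -> cfexpr -> Prop :=
| Red0_inner r s a b t :
    reduction (r, s ++ [:: a, 0, b & t]) (r, s ++ [:: a + b & t])
| Red0_last r s a b :
    reduction (r, s ++ [:: a; b; 0]) (r, s ++ [:: a])
| Red0_first r a b t :
    reduction (r, [:: 0, a, b & t]) (r - a, b :: t)
| Red1_inner r s a b t eps : is_sign eps ->
    reduction (r, s ++ [:: a, eps, b & t])
              (r, s ++ [:: a - eps, b - eps & t])
| Red1_last r s a eps : is_sign eps ->
    reduction (r, s ++ [:: a; eps]) (r, s ++ [:: a - eps])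
| Red1_first r a t eps : is_sign eps ->
    reduction (r, [:: eps, a & t]) (r + eps, a - eps :: t)
| Red23_inner r s a b t eps m : is_sign eps -> (2 <= m)%N ->
    reduction (r, s ++ a :: block23 eps m ++ b :: t)
              (r, s ++ a - eps :: nseq m.-1 (- 3 * eps) ++ b - eps :: t)
| Red23_last r s a eps m : is_sign eps -> (2 <= m)%N ->
    reduction (r, s ++ a :: block23 eps m)
              (r, s ++ a - eps :: nseq m.-1 (- 3 * eps))
| Red23_first r b t eps m : is_sign eps -> (2 <= m)%N ->
    reduction (r, block23 eps m ++ b :: t)
              (r + eps, nseq m.-1 (- 3 * eps) ++ b - eps :: t)
| Red23_whole r eps m : is_sign eps -> (2 <= m)%N ->
    reduction (r, block23 eps m) (r + eps, nseq m.-1 (- 3 * eps)).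

Definition reduces_to : cfexpr -> cfexpr -> Prop :=
  clos_refl_trans cfexpr reduction.

Definition fully_reduced (e : cfexpr) : Prop :=
  forall e', ~ reduction e e'.

Definition is_min_length (K : schubert) (n : nat) : Prop :=
  (exists x e, [/\ fraction_of K x, is_expansion x e & cflength e = n]) /\
  (forall x e, fraction_of K x -> is_expansion x e -> (n <= cflength e)%N).

(* Main.v *)
(* An expansion to which no reduction applies has all |b_i| >= 2, hence a bracket
   of absolute value < 1, so r is the floor or the ceiling of the value. Two such
   expansions of the same number have the same length: if r is the same, strip
   the first coefficient; if not, the brackets y > 0 > y - 1 straddle 0, say with
   y <= 1/2, and the second one starts with -2. As it contains no block
   -2, -3, ..., -3, -2, the next coefficients are constrained enough for an
   induction. Since a reduction keeps the value and shortens the expansion, the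
   irreducible expansions of p/q are the shortest ones; and reading an expansion
   of p/q backwards gives one, of the same length, of p'/q with p p' = 1 mod q. *)

Require Import Defs.
From mathcomp Require Import all_boot all_order all_algebra.
From mathcomp Require Import zify ring lra.

Set Implicit Arguments.
Unset Strict Implicit.
Unset Printing Implicit Defensive.

Import Order.TTheory GRing.Theory Num.Theory.
Local Open Scope ring_scope.

(** * Continued fractions as integer matrices acting on vectors *)

(** The vector [(p, q)] stands for p/q, infinite if q = 0, and [step b] is the matrix [[0, 1],
    [-1, b]]: p/q goes to 1/(b - p/q) with no special case for zero or infinity. *)
Definition step (b : int) (v : int * int) : int * int := (v.2, b * v.2 - v.1).
Definition act (s : seq int) (v : int * int) : int * int := foldr step v s.
Definition shift (r : int) (v : int * int) : int * int := (v.1 + r * v.2, v.2).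
Definition shear (r : int) (v : int * int) : int * int := (v.1, v.2 - r * v.1).
Definition slope (v : int * int) : option rat :=
  if v.2 == 0 then None else Some (v.1%:Q / v.2%:Q).
Definition cfvec (e : cfexpr) : int * int := shift e.1 (act e.2 (0, 1)).

(** Reductions preserve the vector of an expansion only up to sign, which [slope] does not see. *)
Definition eqsign (v w : int * int) : Prop := v = w \/ v = - w.

Lemma pair_int_eq (v w : int * int) : v.1 = w.1 -> v.2 = w.2 -> v = w.
Proof. by case: v w => [a b] [c d] /= -> ->. Qed.

Lemma act_neq0 s v : v != 0 -> act s v != 0.
Proof.
elim: s => //= b s IH /IH; apply: contraNneq; case: (act s v) => [p q] /=.
by rewrite /step /= => -[-> /eqP]; rewrite mulr0 sub0r oppr_eq0 => /eqP ->.
Qed.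

Lemma actN s v : act s (- v) = - act s v.
Proof. by elim: s => //= b s ->; apply: pair_int_eq => /=; ring. Qed.

Lemma act_cat s t v : act (s ++ t) v = act s (act t v).
Proof. exact: foldr_cat. Qed.

Lemma act_eqsign s v w : eqsign v w -> eqsign (act s v) (act s w).
Proof. by case=> ->; rewrite ?actN; [left | right]. Qed.

Lemma shift_eqsign r v w : eqsign v w -> eqsign (shift r v) (shift r w).
Proof.
by case=> ->; [left | right; apply: pair_int_eq => /=; ring].
Qed.

Lemma slope_eqsign v w : eqsign v w -> slope v = slope w.
Proof.
by case=> -> //; rewrite /slope /= oppr_eq0 !mulrNz invrN mulrNN.
Qed.

(** The vector [(0, 0)] is excluded because [step] fixes it, whereas [pinv] sends infinity to 0. *)
Lemma slope_step b v : v != 0 ->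
  slope (step b v) = pinv (paddz b (popp (slope v))).
Proof.
case: v => [p q]; rewrite /slope /step /= => nz.
have [q0|q_neq0] := eqVneq q 0.
  move: nz; rewrite q0 xpair_eqE eqxx andbT mulr0 sub0r oppr_eq0 => /negPf ->.
  by rewrite mul0r.
have qQ : q%:Q != 0 by rewrite intr_eq0.
rewrite /=; have -> : b%:Q + - (p%:Q / q%:Q) = (b * q - p)%:Q / q%:Q.
  by rewrite rmorphB rmorphM /=; field.
case: eqP => [->|/eqP h]; first by rewrite mul0r eqxx.
by rewrite ifN ?invf_div // mulf_neq0 ?invr_neq0 // intr_eq0.
Qed.

Lemma bracket_slope s : bracket s = slope (act s (0, 1)).
Proof.
elim: s => [|b s IH] /=; first by rewrite /slope /= mul0r.
by rewrite IH -slope_step // act_neq0.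
Qed.

Lemma cfvalue_slope e : cfvalue e = slope (cfvec e).
Proof.
case: e => r s; rewrite /cfvalue /cfvec /= bracket_slope.
case: (act s (0, 1)) => p q; rewrite /slope /=; case: eqP => //= /eqP q_neq0.
congr Some; rewrite rmorphD rmorphM /=; field; by rewrite intr_eq0.
Qed.

(** * The reductions as matrix identities *)

(** With [step_shear], this turns the corrections to the neighbours of a removed block into a shift
    on its left and a shear on its right. *)
Lemma step_shift a r v : step (a - r) v = step a (shift r v).
Proof. by apply: pair_int_eq => /=; ring. Qed.

Lemma step_shear a r v : step (a - r) v = shear r (step a v).
Proof. by apply: pair_int_eq => /=; ring. Qed.

Lemma shift_shift r r' v : shift r (shift r' v) = shift (r + r') v.
Proof. by apply: pair_int_eq => /=; ring. Qed.

Lemma step_sign eps v : is_sign eps ->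
  eqsign (step eps v) (shift eps (shear eps v)).
Proof.
by case=> ->; [left | right]; apply: pair_int_eq => /=; ring.
Qed.


Lemma eqsign_trans u v w : eqsign u v -> eqsign v w -> eqsign u w.
Proof. by case=> -> [] ->; rewrite ?opprK; [left | right | right | left]. Qed.

(* The conjugator H = [[2, -eps], [-eps, 1]] turns step (3 eps) into
   - step (-3 eps), and the two ends step (2 eps) into shift and shear. *)
Lemma act_block23 eps m v : is_sign eps -> (2 <= m)%N ->
  eqsign (act (block23 eps m) v)
         (shift eps (act (nseq m.-1 (- 3 * eps)) (shear eps v))).
Proof.
move=> he; case: m => // -[|k] // _.
pose H (w : int * int) := (2 * w.1 - eps * w.2, w.2 - eps * w.1).
have H2 w : eqsign (H (step (2 * eps) w)) (shear eps w).
  by rewrite /H; case: he => ->; [left | right]; apply: pair_int_eq => /=; ring.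
have H3 w : eqsign (H (step (3 * eps) w)) (step (- 3 * eps) (H w)).
  by rewrite /H; case: he => ->; right; apply: pair_int_eq => /=; ring.
have HS w : eqsign (step (2 * eps) w) (shift eps (step (- 3 * eps) (H w))).
  by rewrite /H; case: he => ->; right; apply: pair_int_eq => /=; ring.
rewrite /block23 /= subn2 /=; apply: eqsign_trans (HS _) _.
apply: shift_eqsign; apply: (act_eqsign [:: _]).
elim: k => [|k IH] /=; first exact: H2.
by apply: eqsign_trans (H3 _) _; apply: (act_eqsign [:: _]).
Qed.

Lemma cfvalue_eqsign e e' : eqsign (cfvec e) (cfvec e') -> cfvalue e = cfvalue e'.
Proof. by rewrite !cfvalue_slope => /slope_eqsign. Qed.

(** The empty bracket absorbs the shear, so a removal at the end corrects no following
    coefficient. *)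
Lemma shear_01 eps : shear eps (0, 1) = (0, 1).
Proof. by apply: pair_int_eq => /=; ring. Qed.

Lemma reduction_cfvalue e e' : reduction e e' -> cfvalue e = cfvalue e'.
Proof.
case=> {e e'} => [r s a b t|r s a b|r a b t|r s a b t eps he|r s a eps he
  |r a t eps he|r s a b t eps m he hm|r s a eps m he hm|r b t eps m he hm
  |r eps m he hm]; apply: cfvalue_eqsign; rewrite /cfvec /= ?act_cat /=.
- by apply/shift_eqsign/act_eqsign; right; apply: pair_int_eq => /=; ring.
- by apply/shift_eqsign/act_eqsign; right; apply: pair_int_eq => /=; ring.
- by right; apply: pair_int_eq => /=; ring.
- rewrite (step_shift a) (step_shear b).
  exact/shift_eqsign/act_eqsign/(act_eqsign [:: a])/step_sign.
- rewrite (step_shift a); apply/shift_eqsign/act_eqsign/(act_eqsign [:: a]).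
  by rewrite -{2}(shear_01 eps); apply/step_sign.
- by rewrite (step_shear a) -shift_shift; apply/shift_eqsign/step_sign.
- rewrite (step_shift a) !act_cat /= (step_shear b).
  by apply/shift_eqsign/act_eqsign/(act_eqsign [:: a])/act_block23.
- rewrite (step_shift a); apply/shift_eqsign/act_eqsign/(act_eqsign [:: a]).
  by rewrite -{2}(shear_01 eps); apply: act_block23.
- rewrite (step_shear b) -shift_shift.
  by apply/shift_eqsign/act_block23.
- rewrite -shift_shift; apply/shift_eqsign; rewrite -{2}(shear_01 eps).
  exact: act_block23.
Qed.

Lemma reduction_size e e' : reduction e e' -> (cflength e' < cflength e)%N.
Proof.
by case=> {e e'} *; rewrite /cflength /= ?size_cat /= ?size_cat /=
  ?size_rcons ?size_nseq //=; lia.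
Qed.

(** * Irreducible coefficient sequences *)

Fixpoint tail23 (eps : int) (s : seq int) : bool :=
  if s is b :: s' then (b == 2 * eps) || (b == 3 * eps) && tail23 eps s'
  else false.

Fixpoint has_block23 (s : seq int) : bool :=
  if s is b :: s' then
    [|| (b == 2) && tail23 1 s', (b == -2) && tail23 (-1) s' | has_block23 s']
  else false.

Definition ge2 (s : seq int) : bool := all (fun b : int => 2 <= `|b|) s.

Definition irreducible (s : seq int) : bool := ge2 s && ~~ has_block23 s.

Lemma tail23P eps s : tail23 eps s ->
  exists k t, s = nseq k (3 * eps) ++ 2 * eps :: t.
Proof.
elim: s => //= b s IH /orP[/eqP -> | /andP[/eqP -> /IH[k [t ->]]]].
  by exists 0%N, s.
by exists k.+1, t.
Qed.

Lemma has_block23P s : has_block23 s ->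
  exists s1 eps m t, [/\ is_sign eps, (2 <= m)%N & s = s1 ++ block23 eps m ++ t].
Proof.
have blk eps s' : tail23 eps s' -> exists m t, (2 <= m)%N /\
    2 * eps :: s' = block23 eps m ++ t.
  move=> /tail23P[k [t ->]]; exists k.+2, t; split=> //.
  by rewrite /block23 /= subn2 /= cat_rcons.
elim: s => //= b s IH /or3P[/andP[/eqP -> /blk]|/andP[/eqP -> /blk]|].
- by move=> [m [t [hm ht]]]; exists [::], 1, m, t; split=> //; left.
- by move=> [m [t [hm ht]]]; exists [::], (-1), m, t; split=> //; right.
by move=> /IH[s1 [eps [m [t [he hm ->]]]]]; exists (b :: s1), eps, m, t.
Qed.

Lemma all_split (T : Type) (P : pred T) s : ~~ all P s ->
  exists s1 b s2, ~~ P b /\ s = s1 ++ b :: s2.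
Proof.
elim: s => //= b s IH; rewrite negb_and => /orP[nb|/IH[s1 [c [s2 [hc ->]]]]].
  by exists [::], b, s.
by exists (b :: s1), c, s2.
Qed.

Definition nonint (x : rat) : Prop := forall k : int, x <> k%:Q.

(** The position of the bad coefficient or block selects the rule. Only the brackets [0], [0, b],
    [a, 0] and [eps] have none, and their values are infinite or integral. *)
Lemma not_irreducible r s x : cfvalue (r, s) = Some x -> nonint x ->
  ~~ irreducible s -> exists e', reduction (r, s) e'.
Proof.
move=> hx nx; rewrite /irreducible negb_and negbK => /orP[/all_split|/has_block23P];
  last first.
  move=> [s1 [eps [m [t [he hm ->]]]]].
  case: (lastP s1) t => [|s1' a] [|b t]; rewrite ?cats0 ?cat_rcons /=.
  - by eexists; apply: Red23_whole he hm.
  - by eexists; apply: Red23_first he hm.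
  - by eexists; apply: Red23_last he hm.
  - by eexists; apply: Red23_inner he hm.
move=> [s1 [c [t [hc hs]]]]; rewrite {}hs in hx *.
have [c0|he] : c = 0 \/ is_sign c by rewrite /is_sign; lia.
  subst c; case: (lastP s1) t hx => [|s1' a] [|b t] hx; rewrite ?cat_rcons /=.
  - by move: hx; rewrite cfvalue_slope.
  - case: t hx => [|c t] hx; last by eexists; apply: Red0_first.
    case: (nx (r - b)); move: hx; rewrite cfvalue_slope /slope /cfvec /=.
    rewrite mul0r sub0r /= => -[<-]; rewrite -[LHS]/(_%:~R / (-1)) invrN1 mulrN1 -rmorphN.
    by congr _%:~R; ring.
  - case: (lastP s1') hx => [|s1'' a'] hx; rewrite ?cat_rcons /=.
      case: (nx r); move: hx; rewrite cfvalue_slope /slope /cfvec /=.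
      rewrite mulr0 sub0r /= => -[<-]; rewrite -[LHS]/(_%:~R / (-1)) invrN1 mulrN1 -rmorphN.
      by congr _%:~R; ring.
    by eexists; apply: Red0_last.
  - by eexists; apply: Red0_inner.
case: (lastP s1) t hx => [|s1' a] [|b t] hx; rewrite ?cat_rcons /=.
- case: (nx (r + c)); rewrite -[RHS]addr0; move: hx; rewrite /cfvalue /=.
  by case: he => -> /= -[<-]; rewrite rmorphD /= addr0.
- by eexists; apply: Red1_first he.
- by eexists; apply: Red1_last he.
- by eexists; apply: Red1_inner he.
Qed.

(** * Values of brackets with all |b_i| at least 2 *)

(* Agrees with bracket when all |b_i| >= 2; in general not, as 0^-1 = 0. *)
Fixpoint cfrac (s : seq int) : rat :=
  if s is b :: s' then (b%:Q - cfrac s')^-1 else 0.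

Lemma ge2_cases (b : int) : 2 <= `|b| -> 2 <= b%:Q \/ b%:Q <= -2.
Proof.
by rewrite -[2 : rat]/(2%:Q) -[-2 : rat]/((-2)%:Q) !ler_int; lia.
Qed.

Lemma cfrac_bound s : ge2 s -> -1 < cfrac s < 1.
Proof.
elim: s => //= b s IH /andP[/ge2_cases hb /IH /andP[h1 h2]].
rewrite -ltr_norml normfV invf_lt1 ?normr_gt0.
  by case: hb => hb; [rewrite ltr_normr; apply/orP; left; lra
                     | rewrite ltr_normr; apply/orP; right; lra].
by case: hb => hb; apply/eqP; lra.
Qed.

Lemma bracket_cfrac s : ge2 s -> bracket s = Some (cfrac s).
Proof.
elim: s => //= b s IH /andP[hb hs]; rewrite IH //= ifN //.
have /andP[h1 h2] := cfrac_bound hs.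
by case: (ge2_cases hb) => {}hb; apply/eqP; lra.
Qed.

Lemma cfrac_opp s : cfrac (map -%R s) = - cfrac s.
Proof.
by elim: s => /= [|b s ->]; rewrite ?oppr0 // rmorphN /= -opprD invrN.
Qed.

Lemma tail23_opp eps s : tail23 eps (map -%R s) = tail23 (- eps) s.
Proof. by elim: s => //= b s ->; rewrite !mulrN !eqr_oppLR. Qed.

(** Negation exchanges the blocks of the two signs. *)
Lemma irreducible_opp s : irreducible (map -%R s) = irreducible s.
Proof.
rewrite /irreducible /ge2 all_map; congr (_ && ~~ _).
  by apply: eq_all => b /=; rewrite normrN.
elim: s => //= b s ->; rewrite !tail23_opp !eqr_oppLR !opprK.
by rewrite orbCA.
Qed.

Lemma cfracE b s : ge2 (b :: s) -> cfrac (b :: s) * (b%:Q - cfrac s) = 1.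
Proof.
move=> /= /andP[/ge2_cases hb /cfrac_bound /andP[h1 h2]].
by rewrite mulVf //; case: hb => hb; apply/eqP; lra.
Qed.

Lemma irreducible_ge2 s : irreducible s -> ge2 s.
Proof. by case/andP. Qed.

Lemma irreducible_behead b s : irreducible (b :: s) -> irreducible s.
Proof.
rewrite /irreducible /= !negb_or => /and3P[/andP[_ -> /=] _].
by case/andP.
Qed.

Lemma cfrac_eq0 s : ge2 s -> cfrac s = 0 -> s = [::].
Proof.
by case: s => // b s /cfracE h e; move: h; rewrite e mul0r => /eqP; rewrite eq_sym oner_eq0.
Qed.

(** * Irreducible brackets whose values differ by an integer *)

(** Here u = 1/S and v = 1/T, with T in (-1, -1/2]; the last equation is S = 1 + T with denominators
    cleared. *)
Lemma inverse_gap (S T u v : rat) : S * u = 1 -> T * v = 1 -> S = 1 + T ->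
  -1 < T -> S <= 2^-1 -> [/\ 2 <= u, -2 <= v, v < -1 & v * (1 - u) = u].
Proof.
move=> es et hst hT hS; have S_gt0 : 0 < S by lra.
have T_lt0 : T < 0 by lra.
split.
- by rewrite -subr_ge0 -(pmulr_rge0 _ S_gt0); lra.
- by rewrite -subr_ge0 -(nmulr_rle0 _ T_lt0); lra.
- by rewrite -subr_gt0 -(nmulr_rlt0 _ T_lt0); lra.
apply/eqP; rewrite -subr_eq0; apply/eqP.
have -> : v * (1 - u) - u =
  v * (1 - S * u) - u * (1 - T * v) + u * v * (S - (1 + T)) by ring.
by rewrite es et hst; ring.
Qed.

(** A new block would have to start with c + 1 = -2; then c = -3, and -2, c already began a
    block. *)
Lemma irreducible_bump (c : int) s : c <= -3 -> irreducible [:: -2, c & s] ->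
  irreducible (c + 1 :: s).
Proof.
move=> hc /andP[/and3P[_ _ hs] hN]; apply/andP; split.
  by apply/andP; split; [lia | exact: hs].
apply: contra hN => /or3P[/andP[/eqP c2 _]|/andP[/eqP c2 ht]|hb].
- by exfalso; lia.
- have -> : c = 3 * -1 by lia.
  by apply/or3P; constructor 2; apply/andP; split=> //; apply/orP; right; apply/andP.
- by apply/or3P; constructor 3; apply/or3P; constructor 3.
Qed.

(* The case of two irreducible brackets s, t whose values straddle 0, the
   positive one being at most 1/2. Then t starts with -2, and s with 2 or 3;
   stripping two coefficients of each in the first case, and one in the second,
   leaves irreducible sequences whose values still differ by an integer. *)
Lemma size_irreducible_step s t : irreducible s -> irreducible t ->
    (forall s' t' r, (size s' + size t' < size s + size t)%N ->
      irreducible s' -> irreducible t' -> cfrac s' = r%:Q + cfrac t' ->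
      size s' = size t') ->
  cfrac s = 1 + cfrac t -> cfrac s <= 2^-1 -> size s = size t.
Proof.
move=> irs irt IH hst hs.
have gs := irreducible_ge2 irs; have gt := irreducible_ge2 irt.
have /andP[_ s2] := cfrac_bound gs; have /andP[t1 _] := cfrac_bound gt.
case: s => [|b s] in irs IH hst hs gs s2 *.
  by exfalso; move: hst; rewrite [cfrac [::]]/= => ?; lra.
case: t => [|c t] in irt IH hst gt t1 *.
  by exfalso; move: hst; rewrite [cfrac [::]]/= => ?; lra.
have irs' := irreducible_behead irs; have irt' := irreducible_behead irt.
have gs' := irreducible_ge2 irs'; have gt' := irreducible_ge2 irt'.
have /andP[z1 z2] := cfrac_bound gs'; have /andP[z'1 z'2] := cfrac_bound gt'.
have [hu hv hv' huv] := inverse_gap (cfracE gs) (cfracE gt) hst t1 hs.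
have c_eq : c = -2.
  have [hc _] := andP gt.
  have c1 : -3 < c by rewrite -(ltr_int rat); lra.
  have c2 : c < 0 by rewrite -(ltr_int rat); lra.
  by move: hc c1 c2; clear; lia.
subst c; have [hb _] := andP gs.
have b1 : 1 < b by rewrite -(ltr_int rat); lra.
case: t => [|c2 t] in irt irt' IH hst gt gt' t1 z'1 z'2 hv hv' huv *.
  move: huv; rewrite [cfrac [::]]/= => huv.
  have b3 : b < 3 by rewrite -(ltr_int rat); lra.
  have b2 : b = 2 by move: b1 b3; clear; lia.
  have s0 : cfrac s = 0 by move: huv; rewrite b2; lra.
  by rewrite (cfrac_eq0 gs' s0).
have irt'' := irreducible_behead irt'; have gt'' := irreducible_ge2 irt''.
have /andP[y1 y2] := cfrac_bound gt''; have ez' := cfracE gt'.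
have [hc2 _] := andP gt'.
set z' := cfrac (c2 :: t) in z'1 z'2 hv hv' huv ez'.
set z := cfrac s in z1 z2 hu huv; set y := cfrac t in y1 y2 ez'.
have z'_lt0 : z' < 0.
  rewrite lt_neqAle; apply/andP; split; last by lra.
  by apply/eqP => z'0; move: ez'; rewrite z'0 mul0r => /eqP; rewrite eq_sym oner_eq0.
(* The coefficient [c2] is negative, and -2, -2 would be a block. *)
have c2_le : c2 <= -3.
  have : c2%:Q - y < 0 by rewrite -(nmulr_rgt0 _ z'_lt0) ez'.
  move=> h; have c2_lt1 : c2 < 1 by rewrite -(ltr_int rat); lra.
  have c2_neq : c2 != -2.
    by apply/eqP => c2_eq; move: irt; rewrite c2_eq /irreducible /= andbF.
  by move: hc2 c2_lt1 c2_neq; clear; lia.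
have c2Q : c2%:Q <= -3 by rewrite -[-3 : rat]/((-3)%:Q) ler_int.
(* With u = w + 2 and v = -2 - z', the relation between u and v becomes w + z' (1 + w) = 0. Hence -w
   is the value of [c2 + 1 :: t]. *)
pose w := b%:Q - z - 2.
have hw : w * (c2%:Q - y + 1) = -1.
  have h : w + z' * (1 + w) = 0 by rewrite /w; lra.
  have -> : w * (c2%:Q - y + 1) = (w + z' * (1 + w)) * (c2%:Q - y)
    + (1 + w) * (1 - z' * (c2%:Q - y)) - 1 by ring.
  by rewrite h ez'; ring.
have hX : c2%:Q - y + 1 < -1 by lra.
have w_gt0 : 0 < w by rewrite -(nmulr_llt0 _ (lt_trans hX _)) ?hw.
have w_lt1 : w < 1.
  have X0 : c2%:Q - y + 1 < 0 by lra.
  by rewrite -subr_gt0 -(nmulr_llt0 _ X0); lra.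
have b4 : b < 4 by rewrite -(ltr_int rat); rewrite /w in w_lt1; lra.
have [b2|b3] : b = 2 \/ b = 3 by move: b1 b4; clear; lia.
  (* For b = 2, inverting z = -w exposes the next coefficient [b'] against [c2 + 1]. *)
  have z_eq : z = - w by rewrite /w b2; lra.
  have z_neq0 : z != 0 by rewrite z_eq oppr_eq0 gt_eqF.
  subst z.
  case: s => [|b' s] in irs irs' IH hst hs gs gs' s2 z1 z2 hu huv w hw w_gt0
    w_lt1 z_eq z_neq0 *; first by case/eqP: z_neq0.
  have hX' : b'%:Q - cfrac s = c2%:Q - y + 1.
    by apply: (mulfI z_neq0); rewrite cfracE // {1}z_eq mulNr hw opprK.
  congr _.+2; apply: (IH s t (b' - c2 - 1)).
  - by clear; rewrite /=; lia.
  - exact: irreducible_behead irs'.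
  - exact: irt''.
  by rewrite -/y !rmorphB /=; lra.
(* For b = 3, z = 1 - w, so [s] is compared with [c2 + 1 :: t], which has the length of
   [c2 :: t]. *)
congr _.+1; apply: (IH s (c2 + 1 :: t) 1).
- by clear; rewrite /=; lia.
- exact: irs'.
- exact: irreducible_bump.
have X_neq0 : c2%:Q - y + 1 != 0 by rewrite lt_eqF //; lra.
have -> : cfrac (c2 + 1 :: t) = - w.
  apply: (mulIf X_neq0); rewrite /= -/y rmorphD /= mulNr hw opprK.
  by rewrite addrAC mulVf // addrAC.
by rewrite -/z /w b3; lra.
Qed.

Lemma size_irreducible s t (r : int) : irreducible s -> irreducible t ->
  cfrac s = r%:Q + cfrac t -> size s = size t.
Proof.
have [N] := ubnP (size s + size t)%N.
elim: N s t r => // N IHN s t r hN irs irt hst.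
have {hN}IH s' t' r' : (size s' + size t' < size s + size t)%N ->
    irreducible s' -> irreducible t' -> cfrac s' = r'%:Q + cfrac t' ->
    size s' = size t'.
  by move=> h; apply: IHN; lia.
(* Lengths are fixed only up to order, so that the pair may be swapped under the same induction
   hypothesis. *)
have gap1 s' t' : size s' = size s /\ size t' = size t \/
    size s' = size t /\ size t' = size s ->
    irreducible s' -> irreducible t' -> cfrac s' = 1 + cfrac t' ->
    cfrac s' <= 2^-1 -> size s' = size t'.
  move=> hsz irs' irt'; apply: size_irreducible_step => // s'' t'' r' h.
  by apply: IH; lia.
have gap1' s' t' : size s' = size s /\ size t' = size t \/
    size s' = size t /\ size t' = size s ->
    irreducible s' -> irreducible t' -> cfrac s' = 1 + cfrac t' ->
    size s' = size t'.
  (* If the positive value exceeds 1/2, negate and swap: - cfrac t' = 1 - cfrac s' is below 1/2. *)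
  move=> hsz irs' irt' h; have [le2|gt2] := lerP (cfrac s') 2^-1; first exact: gap1.
  rewrite -(size_map -%R s') -(size_map -%R t'); symmetry.
  apply: gap1; rewrite ?(size_map -%R s') ?(size_map -%R t') ?irreducible_opp ?cfrac_opp //; last 2 first.
  - by lra.
  - by lra.
  by case: hsz => -[-> ->]; [right | left].
have /andP[s1 s2] := cfrac_bound (irreducible_ge2 irs).
have /andP[t1 t2] := cfrac_bound (irreducible_ge2 irt).
have r_lt2 : r < 2 by rewrite -(ltr_int rat); lra.
have r_gtN2 : -2 < r by rewrite -(ltr_int rat); lra.
have [r0|[r1|rN1]] : r = 0 \/ r = 1 \/ r = -1.
  by move: r_lt2 r_gtN2; clear; lia.
- move: hst; rewrite r0 add0r; clear gap1 gap1' s1 s2 t1 t2.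
  case: s => [|b s] in irs IH *.
    by move=> /esym /(cfrac_eq0 (irreducible_ge2 irt)) ->.
  case: t => [|c t] in irt IH *.
    by move=> /(cfrac_eq0 (irreducible_ge2 irs)).
  rewrite /= => /invr_inj h; congr _.+1.
  apply: (IH s t (b - c)) => /=; first by lia.
  - exact: irreducible_behead irs.
  - exact: irreducible_behead irt.
  by rewrite rmorphB /=; lra.
- by apply: gap1' => //; [left | rewrite hst r1].
- by symmetry; apply: gap1' => //; [right | rewrite hst rN1; lra].
Qed.

(** * Minimality for a fixed fraction *)

Lemma cfvalue_cfrac r s : ge2 s -> cfvalue (r, s) = Some (r%:Q + cfrac s).
Proof. by move=> gs; rewrite /cfvalue /= bracket_cfrac. Qed.

(** Shorten [e] until it is irreducible, then compare lengths; confluence is not involved. Zero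
    coefficients are allowed in [e], as reductions may create them. *)
Lemma irreducible_minimal e e' x : nonint x -> cfvalue e = Some x ->
  cfvalue e' = Some x -> irreducible e'.2 -> (cflength e' <= cflength e)%N.
Proof.
move=> nx; have [N] := ubnP (cflength e); elim: N e => // N IH e hN he he' ir'.
have [ir|nir] := boolP (irreducible e.2).
  case: e e' {hN IH} he he' ir ir' => [r s] [r' s'] /= he he' ir ir'.
  move: he he'; rewrite !cfvalue_cfrac ?irreducible_ge2 // => -[<-] [h].
  by rewrite /cflength /= (@size_irreducible s' s (r - r')) // rmorphB /=; lra.
case: e hN he nir => r s hN he /(not_irreducible he nx) [e1 red].
have lt1 := reduction_size red.
have := IH e1 _ _ he' ir'; rewrite -(reduction_cfvalue red) => /(_ _ he).
by lia.
Qed.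

Lemma reduces_to_cfvalue e e' : reduces_to e e' -> cfvalue e = cfvalue e'.
Proof.
elim=> {e e'} // [e e' /reduction_cfvalue // | e e1 e2 _ -> _ -> //].
Qed.

(** * Reversal and passage between fractions of one knot *)

(* The transfer matrix of s is [[A, P], [B, Q]], with A Q - B P = 1; that of
   rev s is [[A, -B], [-P, Q]]. *)
Lemma act_rev s : exists A B P Q : int,
  [/\ A * Q - B * P = 1,
      forall v, act s v = (A * v.1 + P * v.2, B * v.1 + Q * v.2) &
      forall v, act (rev s) v = (A * v.1 - B * v.2, Q * v.2 - P * v.1)].
Proof.
elim: s => [|b s [A [B [P [Q [hdet hs hrev]]]]]].
  by exists 1, 0, 0, 1; split=> // v; apply: pair_int_eq => /=; ring.
exists B, (b * B - A), Q, (b * Q - P); split=> [|v|v].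
- by rewrite -hdet; ring.
- by rewrite /= hs; apply: pair_int_eq => /=; ring.
- by rewrite rev_cons -cats1 act_cat hrev; apply: pair_int_eq => /=; ring.
Qed.

(** Both p/q and n/Q are in lowest terms, so they agree up to a common sign. The determinant makes
    -B inverse to n modulo Q, and the reversed bracket is -B/Q. *)
Lemma cfvalue_rev r s (p p' q : int) : 0 < q -> coprimez p q ->
  cfvalue (r, s) = Some (p%:Q / q%:Q) -> (p' * p = 1 %[mod q])%Z ->
  exists r', cfvalue (r', rev s) = Some (p'%:Q / q%:Q).
Proof.
move=> q_gt0 cpq; have [A [B [P [Q [hdet hs hrev]]]]] := act_rev s.
have q_neq0 : q != 0 by rewrite gt_eqF.
rewrite cfvalue_slope /cfvec /slope /= hs /= !mulr0 !mulr1 !add0r.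
case: eqP => // /eqP Q_neq0 [].
set n := P + r * Q => /eqP; rewrite eqr_div ?intr_eq0 // -!intrM eqr_int => /eqP hn hp.
have cnQ : coprimez n Q.
  by apply/coprimezP; exists (- B, A + B * r); rewrite /= -hdet /n; ring.
have dQ : (Q %| q)%Z.
  by rewrite -(@Gauss_dvdzr _ n) 1?coprimez_sym // hn dvdz_mull.
have dq : (q %| Q)%Z.
  by rewrite -(@Gauss_dvdzr _ p) 1?coprimez_sym // -hn dvdz_mull.
have [sg hsg hq] : exists2 sg : int, sg * sg = 1 & q = sg * Q.
  case/dvdzP: dQ hn => u hu; case/dvdzP: dq => v hv _.
  have /eqP uv : (u * v - 1) * q == 0 by rewrite mulrBl mul1r -mulrA -hv -hu subrr.
  exists u => //; move/eqP: uv; rewrite mulf_eq0 (negPf q_neq0) orbF subr_eq0.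
  move=> /eqP /(congr1 absz) /eqP; rewrite abszM muln_eq1 => /andP[/eqP hu1 _].
  by have [->|->] : u = 1 \/ u = -1 by move: hu1; clear; lia.
have hpn : p = sg * n.
  by apply: (mulIf Q_neq0); rewrite -hn hq; ring.
(* Multiply by n, which is prime to Q: p' p - 1 is divisible by q, and n B + 1 = (A + r B) Q. *)
have /dvdzP[l hl] : (Q %| p' * sg + B)%Z.
  rewrite -(@Gauss_dvdzr _ n) 1?coprimez_sym //.
  have /dvdzP[k hk] : (q %| p' * p - 1)%Z by rewrite -eqz_mod_dvd; apply/eqP.
  apply/dvdzP; exists (k * sg + A + B * r).
  have -> : n * (p' * sg + B) = (p' * p - 1) + n * B + 1 by rewrite hpn; ring.
  rewrite hk hq [in LHS]/n.
  have -> : k * (sg * Q) + (P + r * Q) * B + 1 =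
    (k * sg + B * r) * Q + (B * P + 1) by ring.
  by rewrite -hdet; ring.
have hl' : p' = l * q - sg * B.
  have -> : l * q = sg * (p' * sg + B) by rewrite hl hq; ring.
  by rewrite -[LHS]mulr1 -hsg; ring.
exists l; rewrite cfvalue_slope /cfvec /slope /= hrev /=.
rewrite !mulr0 !mulr1 sub0r subr0 ifN //.
congr Some; apply/eqP; rewrite eqr_div ?intr_eq0 //.
rewrite -!intrM eqr_int; apply/eqP; rewrite hl'.
have -> : (l * q - sg * B) * Q = l * q * Q - B * (sg * Q) by ring.
by rewrite -hq; ring.
Qed.

Theorem theorem2p3 (K : schubert) (x : rat) (e e' : cfexpr) (n : nat)
    (hx : fraction_of K x) (he : is_expansion x e)
    (hred : reduces_to e e') (hirr : fully_reduced e')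
    (hn : cflength e' = n) :
  is_min_length K n.
Proof.
case: hx => K1 [[hq1 hp1] hx].
have q1_gt0 : 0 < sq K1 by have := sq_ge3 K1; lia.
have nx : nonint x.
  move=> k; rewrite hx => hk; have hp : sp K1 = k * sq K1.
    by apply: (@intr_inj rat); rewrite intrM -hk divfK // intr_eq0 gt_eqF.
  have := sp_coprime K1; rewrite hp coprimezMl => /andP[_].
  by rewrite /coprimez gcdzz; have := sq_ge3 K1; clear; lia.
have he' : cfvalue e' = Some x by rewrite -(reduces_to_cfvalue hred); case: he.
have ir : irreducible e'.2.
  apply/negPn/negP => nir; case: e' {hred} he' hirr nir hn => r s he' hirr nir _.
  by have [e1 /hirr] := not_irreducible he' nx nir.
split.
  exists x, e'; split=> //; first by exists K1.
  split=> //; have := irreducible_ge2 ir; apply: sub_all => b.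
  by apply: contraTneq => ->.
move=> x2 [r s] [K2 [[hq2 hp2] hx2]] [he2 _].
have q12 : sq K2 = sq K1 by rewrite hq1 hq2.
have hmod : (sp K1 = sp K2 %[mod sq K2])%Z \/ (sp K1 * sp K2 = 1 %[mod sq K2])%Z.
  rewrite q12 hq1; move: hp1 hp2 => -[h1|h1] [h2|h2].
  - by left; rewrite h1 h2.
  - by right; rewrite -modzMml h1 modzMml mulrC.
  - by right; rewrite -modzMmr h2 modzMmr.
  - left; rewrite -[sp K1]mulr1 -modzMmr -h2 modzMmr.
    by rewrite mulrCA -modzMmr h1 modzMmr mulr1.
have q2_gt0 : 0 < sq K2 by rewrite q12.
(* Congruent numerators differ by a change of [r], inverse ones by reversal; both keep the
   length. *)
have [e3 he3 <-] : exists2 e3, cfvalue e3 = Some x & cflength e3 = cflength (r, s).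
  case: hmod => hmod.
    have /dvdzP[k hk] : (sq K2 %| sp K1 - sp K2)%Z by rewrite -eqz_mod_dvd; apply/eqP.
    exists (r + k, s) => //; move: he2; rewrite /cfvalue /=.
    case: (bracket s) => //= y [hy]; congr Some.
    rewrite hx -q12 -[sp K1](subrK (sp K2)) hk !rmorphD rmorphM /= mulrDl -hx2 -hy.
    by rewrite mulfK ?intr_eq0 ?gt_eqF //; ring.
  rewrite hx2 in he2.
  have [r' hr'] := cfvalue_rev q2_gt0 (sp_coprime K2) he2 hmod.
  by exists (r', rev s); rewrite ?hr' ?hx ?q12 // /cflength size_rev.
by rewrite -hn; apply: irreducible_minimal he3 he' ir.
Qed.
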